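(* Let $G$ be a connected graph on $n$ vertices, let $k \geq \zeta(G)$ be a positive integer, and let $C_1,\ldots,C_m$ be the distance colorings of $G$ for this $k$. Then the number of rows of the game structure of $G$ according to $C_1,\ldots,C_m$ equals $\mathrm{lcapt}_k(G)$.
   Context: Game structure: given a graph $G$ and colorings $C_1,\dots,C_m$ of $V(G)$, rows are built consecutively. Row 1 consists of all singletons $\{v\}$, $v \in V(G)$. For $i \geq 2$, row $i$ consists of all subsets $S \subseteq V(G)$ not appearing in rows $1,\dots,i-1$ for which there exists $j \in \{1,\dots,m\}$ such that every color class of the restriction of $C_j$ to $N[S]$ (i.e. every nonempty set of the form $\{v \in N[S] : C_j(v) = a\}$) appears in rows $1,\dots,i-1$. Here $N[S]$ is the closed neighborhood of $S$. Rows are added as long as they are nonempty; the number of rows is the number of nonempty rows obtained. Distance colorings: for every $S=\{s_1,\dots,s_\ell\}\subseteq V(G)$ with $|S| \leq k$, the coloring $C_S$ assigns to $v \in V(G)$ the vector $(d(v,s_1),\dots,d(v,s_\ell))$; the distance colorings are all such $C_S$. The localization game on a connected graph $G$ with $k$ cops: the robber first chooses a starting vertex (invisible to the cops; the robber knows the cops' strategy). Then rounds are played; in each round the cops choose (probe) any $k$ vertices $c_1,\dots,c_k$ and learn $(d(c_1,r),\dots,d(c_k,r))$, where $r$ is the robber's current vertex; then the robber moves to a neighbor or stays put. The cops win if after finitely many rounds they can determine the robber's exact position. $\zeta(G)$ is the minimum $k$ for which the cops have a winning strategy, and for $k \geq \zeta(G)$, $\mathrm{lcapt}_k(G)$ is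 the number of rounds (probes) needed for $k$ cops to determine the robber's location under optimal play (cops minimizing, robber maximizing).
   Formalization: lcapt_k(G) is taken as the minimum number of probes plus one (the robber's opening choice counts as a round, and at least one probe is made), because the number of rows always exceeds the number of probes by one: K_2 with k = 1 needs one probe but has two rows. *)

(* Defs.v *)
From mathcomp Require Import all_boot.
From mathcomp Require Import boolp.

Set Implicit Arguments.
Unset Strict Implicit.
Unset Printing Implicit Defensive.

(* Minimum of a set of naturals; the default 0 is returned on the empty set. *)
Definition least (P : nat -> Prop) : nat :=
  match pselect (exists n, `[< P n >]) with
  | left exP => ex_minn exP
  | right _ => 0
  end.

Record sgraph := SGraph {
  vertex :> finType;
  adj : rel vertex;
  adj_sym : symmetric adj;
  adj_irrefl : irreflexive adj }.

Definition connected_graph (G : sgraph) : Prop :=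
  0 < #|G| /\ forall x y : G, connect (@adj G) x y.

Definition dist (G : sgraph) (x y : G) : nat :=
  least (fun m => exists p : seq G,
    [/\ path (@adj G) x p, last x p = y & size p = m]).

Definition closed_nbhd (G : sgraph) (S : {set G}) : {set G} :=
  S :|: [set v | [exists u in S, adj u v]].

Section GameStructure.
Variables (G : sgraph) (A : eqType) (J : finType) (C : J -> G -> A).

(* Only nonempty color classes are listed: each is the class of some v in X. *)
Definition color_classes (f : G -> A) (X : {set G}) : {set {set G}} :=
  [set [set u in X | f u == f v] | v in X].

Definition new_sets (P : {set {set G}}) : {set {set G}} :=
  [set S | (S \notin P) &&
           [exists j, color_classes (C j) (closed_nbhd S) \subset P]].

(* next_row i P is row i.+1 when P is the union of rows 1, ..., i. *)
Definition next_row (i : nat) (P : {set {set G}}) : {set {set G}} :=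
  if i is 0 then [set [set v] | v : G] else new_sets P.

Fixpoint rows_upto (i : nat) : {set {set G}} :=
  if i is i'.+1 then rows_upto i' :|: next_row i' (rows_upto i') else set0.

(* Rows are numbered from 1. *)
Definition row (i : nat) : {set {set G}} :=
  if i is i'.+1 then next_row i' (rows_upto i') else set0.

Definition num_rows : nat := least (fun i => row i.+1 = set0).

End GameStructure.

Definition distance_colorings (G : sgraph) (k : nat)
    (S : {S : {set G} | #|S| <= k}) (v : G) : seq nat :=
  [seq dist v s | s <- enum (val S)].

Section LocalizationGame.
Variables (G : sgraph) (k : nat).

(* The k vertices probed next, given the list of all previous answers. *)
Definition strategy := seq (seq nat) -> k.-tuple G.

(* r i is the position of the robber at the time of the (i+1)-st probe. *)
Definition robber_walk (r : nat -> G) : Prop :=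
  forall i, (r i.+1 == r i) || adj (r i) (r i.+1).

Fixpoint answers (sigma : strategy) (r : nat -> G) (t : nat) : seq (seq nat) :=
  if t is t'.+1 then
    let h := answers sigma r t' in
    rcons h [seq dist c (r t') | c <- sigma h]
  else [::].

(* The first t.+1 answers determine where the robber is at the last probe. *)
Definition located (sigma : strategy) (r : nat -> G) (t : nat) : Prop :=
  forall r', robber_walk r' ->
    answers sigma r' t.+1 = answers sigma r t.+1 -> r' t = r t.

Definition cops_win : Prop :=
  exists sigma : strategy, forall r, robber_walk r ->
    exists t, located sigma r t.

Definition cops_win_within (t : nat) : Prop :=
  exists sigma : strategy, forall r, robber_walk r ->
    exists2 s, s < t & located sigma r s.

Definition probes_needed : nat := least cops_win_within.

(* Rounds are counted from the opening one, in which the robber chooses a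
   starting vertex and the cops have no information yet; every later round
   contributes one probe. Counting probes alone would give a value smaller by
   one than the number of rows: on the complete graph with two vertices one
   probe suffices for k = 1, while the game structure has two rows. *)
Definition lcapt : nat := probes_needed.+1.

End LocalizationGame.

Definition zeta (G : sgraph) : nat := least (cops_win G).

(* Main.v *)
Require Import Defs.
From mathcomp Require Import all_boot.
From mathcomp Require Import boolp.

Set Implicit Arguments.
Unset Strict Implicit.
Unset Printing Implicit Defensive.

(** Call a set of possible robber positions just after a probe solved at level
    [i] if it lies in rows [1, ..., i]. Inductively, it is solved at level [i]
    exactly when it is a singleton or the cops can locate the robber with at most
    [i - 1] further probes: between probes a set [S] of candidates spreads to
    [N[S]], and the answer to a probe selects a color class of [N[S]]. As
    [N[V(G)] = V(G)], the cops win with [t > 0] probes iff [V(G)] lies in rows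
    [1, ..., t + 1]. Rows are hereditary, so the structure is complete as soon as
    it contains [V(G)]; no row before that is empty, since an empty row stops the
    growth. The bound [k >= zeta(G)] yields a bound on the number of probes by
    Konig's lemma. *)

(** * Minima of sets of naturals, and Konig's lemma *)

Section Least.
Variable P : nat -> Prop.

Lemma least_spec n : P n -> P (least P) /\ forall m, P m -> least P <= m.
Proof.
move=> Pn; rewrite /least; case: pselect => [exP|[]]; last first.
  by exists n; apply/asboolP.
case: ex_minnP => m /asboolP Pm min_m; split=> // p Pp.
by apply: min_m; apply/asboolP.
Qed.

Lemma least_eq n : P n -> (forall m, P m -> n <= m) -> least P = n.
Proof.
move=> Pn min_n; have [Pl min_l] := least_spec Pn.
by apply/eqP; rewrite eqn_leq min_l // min_n.
Qed.

End Least.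

(** Follow prefixes that have extensions in [Q] of every length; finiteness of [T] lets each of them
    be prolonged by one letter. *)
Lemma konig (T : finType) (Q : seq T -> Prop) :
  (forall s s', Q (s ++ s') -> Q s) ->
  (forall n, exists2 s, size s = n & Q s) ->
  exists r : nat -> T, forall n, Q (mkseq r n).
Proof.
move=> Qpre Qlong.
pose big s := forall n, exists2 s', size s' = n & Q (s ++ s').
have big_ext s : big s -> exists x, big (rcons s x).
  move=> bs; apply: contrapT => /forallNP nb.
  have {}nb x : exists n, forall s', size s' = n -> ~ Q (rcons s x ++ s').
    have /existsNP[n nbn] := nb x.
    by exists n => s' ss' Qs'; apply: nbn; exists s'.
  have [f fP] := choice nb.
  (* If letter [x] fails at length [f x], a continuation of length one more than the largest [f x]
     is too long for its own first letter. *)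
  have [[//|x s'] /= [ss'] Qs'] := bs (\max_x f x).+1.
  apply: (fP x (take (f x) s')).
    by rewrite size_takel // ss' (leq_bigmax_cond (F := f)).
  apply: (Qpre _ (drop (f x) s')).
  by rewrite -catA cat_take_drop cat_rcons.
have big0 : big [::] by move=> n; have [s] := Qlong n; exists s.
have [x0 _] := big_ext _ big0.
have {}big_ext s : exists x, big s -> big (rcons s x).
  by case: (pselect (big s)) => [/big_ext[x ?]|]; [exists x | exists x0].
have [next nextP] := choice big_ext.
pose s := fix s n := if n is m.+1 then rcons (s m) (next (s m)) else [::].
exists (fun n => next (s n)) => n.
have -> : mkseq (fun n => next (s n)) n = s n.
  by elim: n => //= n IHn; rewrite mkseqS IHn.
have bs : big (s n) by elim: n => //= n /nextP.
by have [s' _ /Qpre] := bs 0.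
Qed.

(** * Distances and closed neighborhoods *)

Section Distance.
Variable G : sgraph.

Lemma dist_sym (x y : G) : dist x y = dist y x.
Proof.
rewrite /dist; congr least; apply/funext => m; apply/propext.
suff H (a b : G) : (exists p, [/\ path (@adj G) a p, last a p = b & size p = m]) ->
    exists p, [/\ path (@adj G) b p, last b p = a & size p = m].
  by split; apply: H.
case=> p [pp <- sp]; exists (rev (belast a p)); split.
- by rewrite rev_path (eq_path (e' := @adj G)) // => u v; apply: adj_sym.
- by case: p {pp sp} => //= z p; rewrite rev_cons last_rcons.
- by rewrite size_rev size_belast.
Qed.

Lemma dist_refl (x : G) : dist x x = 0.
Proof. by apply: least_eq => //; exists [::]. Qed.

Lemma dist_eq0 (x y : G) : connect (@adj G) x y -> dist x y = 0 -> x = y.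
Proof.
case/connectP=> p pp yE; rewrite /dist.
have [] := @least_spec (fun m => exists p,
  [/\ path (@adj G) x p, last x p = y & size p = m]) (size p).
  by exists p.
by case=> q [_ <- sq] _ d0; move: sq; rewrite d0 => /size0nil->.
Qed.

Lemma closed_nbhdT : closed_nbhd [set: G] = setT.
Proof. by rewrite /closed_nbhd setTU. Qed.

Lemma closed_nbhdS (S S' : {set G}) :
  S \subset S' -> closed_nbhd S \subset closed_nbhd S'.
Proof.
move=> sSS'; apply: setUSS => //; apply/subsetP => v; rewrite !inE.
by case/exists_inP=> u /(subsetP sSS') uS' uv; apply/exists_inP; exists u.
Qed.

Lemma closed_nbhdP (S : {set G}) v :
  reflect (exists2 u, u \in S & (v == u) || adj u v) (v \in closed_nbhd S).
Proof.
rewrite !inE; apply: (iffP orP) => [[vS|/exists_inP[u uS uv]]|[u uS]].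
- by exists v; rewrite ?eqxx.
- by exists u; rewrite ?uv ?orbT.
- case/orP=> [/eqP->|uv]; [by left | right].
  by apply/exists_inP; exists u.
Qed.

End Distance.

(** * Probes compared with distance colorings *)

Section Probes.
Variables (G : sgraph) (k : nat).
Implicit Types (c : k.-tuple G) (u v : G) (Y : {set G}).

Definition probe c v : seq nat := [seq dist x v | x <- c].

Definition probe_class c Y v : {set G} := [set u in Y | probe c u == probe c v].

Lemma probe_class_refl c Y v : v \in Y -> v \in probe_class c Y v.
Proof. by rewrite inE eqxx andbT. Qed.

Lemma distance_coloring_of_probe c :
  exists j, forall u v, (distance_colorings j u == distance_colorings (k := k) j v)
                        = (probe c u == probe c v).
Proof.
have Sk : #|[set x in c]| <= k by rewrite cardsE -[X in _ <= X](size_tuple c) card_size.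
exists (exist _ [set x in c] Sk) => u v; apply/eqP/eqP => /eq_in_map eq_uv.
  apply/eq_in_map => x xc; rewrite ![dist x _]dist_sym; apply: eq_uv.
  by rewrite mem_enum inE.
apply/eq_in_map => x; rewrite mem_enum inE => xc.
by rewrite ![dist _ x]dist_sym eq_uv.
Qed.

(** A set with fewer than [k] vertices is padded with [x0]. The extra distances may refine the
    partition, so only one implication holds. *)
Lemma probe_of_distance_coloring (x0 : G) (j : {S : {set G} | #|S| <= k}) :
  exists c, forall u v, probe c u = probe c v ->
    distance_colorings j u = distance_colorings j v.
Proof.
case: j => S Sk; exists [tuple nth x0 (enum S) i | i < k] => u v /eq_in_map eq_uv.
apply/eq_in_map => x xS; rewrite ![dist _ x]dist_sym; apply: eq_uv.
have ltk : index x (enum S) < k.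
  by apply: leq_trans (Sk); rewrite cardE index_mem.
by apply/mapP; exists (Ordinal ltk); rewrite ?mem_enum //= nth_index.
Qed.

End Probes.

(** * Rows for arbitrary colorings *)

Section Rows.
Variables (G : sgraph) (A : eqType) (J : finType) (C : J -> G -> A).
Notation P := (rows_upto C).

Lemma rows_upto1 S : (S \in P 1) = [exists v, S == [set v]].
Proof.
rewrite /= set0U; apply/imsetP/existsP => [[v _ ->]|[v /eqP->]]; by exists v.
Qed.

Lemma rows_uptoSS i S :
  (S \in P i.+2) = (S \in P i.+1) ||
    [exists j, color_classes (C j) (closed_nbhd S) \subset P i.+1].
Proof.
rewrite -[P i.+2]/(P i.+1 :|: new_sets C (P i.+1)) in_setU.
by rewrite [S \in new_sets _ _]inE; case: (S \in _).
Qed.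

Lemma rows_upto_sub i m : i <= m -> P i \subset P m.
Proof.
move=> /subnK <-; elim: (m - i) => //= n IHn.
exact: subset_trans IHn (subsetUl _ _).
Qed.

Lemma set1_rows_upto i v : [set v] \in P i.+1.
Proof.
apply: (subsetP (@rows_upto_sub 1 i.+1 _)) => //.
by rewrite rows_upto1; apply/existsP; exists v.
Qed.

Lemma rows_upto_cases i S : S \in P i.+2 ->
  (exists v, S = [set v]) \/
  exists j, color_classes (C j) (closed_nbhd S) \subset P i.+1.
Proof.
elim: i => [|i IHi]; rewrite rows_uptoSS.
  by rewrite rows_upto1 => /orP[/existsP[v /eqP->]|/existsP]; [left; exists v|right].
case/orP=> [/IHi[|[j sub_j]]|/existsP]; [by left | right | by right].
by exists j; apply: subset_trans sub_j (rows_upto_sub _).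
Qed.

Lemma color_classes_subP (f : G -> A) (Y : {set G}) (Q : {set {set G}}) :
  reflect (forall v, v \in Y -> [set u in Y | f u == f v] \in Q)
          (color_classes f Y \subset Q).
Proof.
apply: (iffP subsetP) => [sub v vY|sub _ /imsetP[v vY ->]]; last exact: sub.
by apply: sub; apply/imsetP; exists v.
Qed.

(** Each color class of [N[S]] is a nonempty subset of a class of [N[S']], so induction applies. The
    empty set is excluded because row 1 has only singletons. *)
Lemma rows_upto_hereditary i (S S' : {set G}) :
  S != set0 -> S \subset S' -> S' \in P i.+1 -> S \in P i.+1.
Proof.
elim: i S S' => [|i IHi] S S' S0 sSS'.
  rewrite !rows_upto1 => /existsP[v /eqP S'v]; apply/existsP; exists v.
  by move: sSS'; rewrite S'v subset1 (negPf S0) orbF.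
rewrite !rows_uptoSS => /orP[/IHi-> //|/existsP[j /color_classes_subP sub_j]].
apply/orP; right; apply/existsP; exists j; apply/color_classes_subP => v vS.
have sN := closed_nbhdS sSS'.
apply: IHi (sub_j v (subsetP sN v vS)).
  by apply/set0Pn; exists v; apply/setIdP.
by apply/subsetP => u /setIdP[uN fu]; apply/setIdP; rewrite (subsetP sN).
Qed.

Lemma set0_rows_upto (j : J) i : set0 \in P i.+2.
Proof.
apply: (subsetP (@rows_upto_sub 2 i.+2 _)) => //.
rewrite rows_uptoSS; apply/orP; right; apply/existsP; exists j.
apply/color_classes_subP => v /closed_nbhdP[u]; by rewrite inE.
Qed.

Lemma rows_upto_stable i m : row C i.+2 = set0 -> i <= m -> P m.+1 = P i.+1.
Proof.
move=> rowi /subnK <-; elim: (m - i) => // n IHn.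
rewrite -[LHS]/(P (n + i).+1 :|: new_sets C (P (n + i).+1)) IHn.
by rewrite -[new_sets _ _]/(row C i.+2) rowi setU0.
Qed.

(** An empty row among the first [t.+2] would freeze the growth and give [P t.+2 = P t.+1]. For
    [t = 0] the whole graph may already be in row 1, but the empty set, having no color classes,
    first appears in row 2. *)
Lemma num_rows_eq (j : J) t : 0 < #|G| ->
  [set: G] \in P t.+2 -> (0 < t -> [set: G] \notin P t.+1) ->
  num_rows C = t.+2.
Proof.
move=> G0 Tt minT; apply: least_eq.
  apply/setP => S; rewrite in_set0 -[row C _]/(new_sets C (P t.+2)) [LHS]in_set.
  apply: negbTE; rewrite negb_and negbK; apply/orP; left.
  have [->|S0] := eqVneq S set0; first exact: set0_rows_upto j t.
  exact: rows_upto_hereditary S0 (subsetT _) Tt.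
case=> [/setP row1|i rowi].
  have /card_gt0P[v _] := G0.
  by have := row1 [set v]; rewrite in_set0 => /imsetP[]; exists v.
rewrite ltnNge; apply/negP => leit; have stab := rows_upto_stable rowi.
have PtE : P t.+2 = P t.+1 by rewrite !stab // ltnW.
case: t => [|t] in Tt minT leit PtE *; last by rewrite PtE (negPf (minT _)) in Tt.
have : set0 \in P 1 by rewrite -PtE set0_rows_upto.
by rewrite rows_upto1 => /existsP[v /eqP/setP/(_ v)]; rewrite !inE eqxx.
Qed.

End Rows.

(** * Candidate sets, and the translation between strategies and rows *)

Section Candidates.
Variables (G : sgraph) (k : nat).
Implicit Types (sigma : strategy G k) (r v : nat -> G).
Notation P := (rows_upto (@distance_colorings G k)).

(** Padding a coloring to a probe only refines its classes, which heredity of the rows absorbs. *)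
Lemma distance_classes_probe (x0 : G) i S :
  (exists j, color_classes (distance_colorings (k := k) j) (closed_nbhd S)
     \subset P i.+1)
  <-> exists c : k.-tuple G, forall u, u \in closed_nbhd S ->
        probe_class c (closed_nbhd S) u \in P i.+1.
Proof.
split=> [[j /color_classes_subP sub_j]|[c sub_c]].
  have [c cP] := probe_of_distance_coloring x0 j; exists c => u uN.
  apply: rows_upto_hereditary (sub_j u uN).
    by apply/set0Pn; exists u; apply: probe_class_refl.
  by apply/subsetP => w /setIdP[wN /eqP/cP/eqP eq_wu]; apply/setIdP.
have [j jP] := distance_coloring_of_probe c; exists j.
apply/color_classes_subP => u uN.
rewrite (_ : [set w in _ | _] = probe_class c (closed_nbhd S) u); first exact: sub_c.
by apply/setP => w; rewrite !in_set jP.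
Qed.

(* [before sigma v t] and [after sigma v t] are the positions that the cops cannot
   exclude just before and just after the probe number [t.+1]. Only the answers
   along [v] matter, so [v] need not be a walk; this allows a class of candidates
   to be represented by an arbitrary member. *)
Fixpoint before sigma v (t : nat) : {set G} :=
  if t is t'.+1 then
    closed_nbhd (probe_class (sigma (answers sigma v t')) (before sigma v t') (v t'))
  else setT.

Definition after sigma v t : {set G} :=
  probe_class (sigma (answers sigma v t)) (before sigma v t) (v t).

Lemma beforeS sigma v t : before sigma v t.+1 = closed_nbhd (after sigma v t).
Proof. by []. Qed.

Lemma answersS sigma v t :
  answers sigma v t.+1
    = rcons (answers sigma v t) (probe (sigma (answers sigma v t)) (v t)).
Proof. by []. Qed.

Lemma answersS_inj sigma v v' t :
  answers sigma v t.+1 = answers sigma v' t.+1 ->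
  answers sigma v t = answers sigma v' t /\
  probe (sigma (answers sigma v t)) (v t) = probe (sigma (answers sigma v t)) (v' t).
Proof. by rewrite !answersS => /rcons_inj[-> ->]. Qed.

Lemma answers_take sigma v v' s t : s <= t ->
  answers sigma v t = answers sigma v' t -> answers sigma v s = answers sigma v' s.
Proof.
move=> /subnK <-; elim: (t - s) => //= n IHn /answersS_inj[+ _]; exact: IHn.
Qed.

Lemma eq_answers sigma v v' t :
  (forall i, i < t -> v i = v' i) -> answers sigma v t = answers sigma v' t.
Proof.
elim: t => //= t IHt eq_v; rewrite IHt ?eq_v // => i it.
by apply: eq_v; apply: leqW.
Qed.

Lemma before_answers sigma v v' t :
  answers sigma v t = answers sigma v' t -> before sigma v t = before sigma v' t.
Proof.
elim: t => // t IHt /answersS_inj[eq_a eq_p]; rewrite /= IHt // -eq_a.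
by congr closed_nbhd; apply/setP => u; rewrite !inE eq_p.
Qed.

Lemma after_answers sigma v v' t :
  answers sigma v t.+1 = answers sigma v' t.+1 -> after sigma v t = after sigma v' t.
Proof.
move=> /answersS_inj[eq_a eq_p]; rewrite /after (before_answers eq_a) -eq_a.
by apply/setP => u; rewrite !inE eq_p.
Qed.

Lemma mem_before_walk sigma r t : robber_walk r -> r t \in before sigma r t.
Proof.
move=> wr; elim: t => [|t IHt]; first exact: in_setT.
by rewrite beforeS; apply/closed_nbhdP; exists (r t); rewrite ?probe_class_refl.
Qed.

Lemma mem_after_walk sigma r v t : robber_walk r ->
  answers sigma r t.+1 = answers sigma v t.+1 -> r t \in after sigma v t.
Proof.
move=> wr /after_answers <-.
by apply: probe_class_refl; apply: mem_before_walk.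
Qed.

Lemma after_walk sigma v t u : u \in after sigma v t ->
  exists r, [/\ robber_walk r, answers sigma r t.+1 = answers sigma v t.+1 & r t = u].
Proof.
elim: t u => [|t IHt] u.
  rewrite inE => /andP[_ /eqP eq_u]; exists (fun=> u); split=> //.
    by move=> i; rewrite eqxx.
  by rewrite !answersS eq_u.
rewrite /after beforeS inE => /andP[/closed_nbhdP[w /IHt[r [wr eq_a rt]] wu] /eqP eq_u].
(* The walk reaching the neighbor [w] at time [t] steps to [u] and stays there. *)
pose r' i := if i <= t then r i else u.
have r'le i : i < t.+1 -> r' i = r i by rewrite /r' ltnS => ->.
have r't : r' t.+1 = u by rewrite /r' ltnn.
exists r'; split=> //.
  move=> i; rewrite /r'; case: (ltngtP i t) => [//|ti|->].
  - by rewrite eqxx.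
  - by rewrite rt.
by rewrite !(answersS _ _ t.+1) (eq_answers _ r'le) eq_a r't eq_u.
Qed.

Lemma locatedP sigma r t :
  robber_walk r -> located sigma r t <-> exists u, after sigma r t = [set u].
Proof.
move=> wr; have rt : r t \in after sigma r t by apply: mem_after_walk.
split=> [loc|[u uE] r' wr' /(mem_after_walk wr')].
  exists (r t); apply/setP => u; rewrite inE; apply/idP/eqP => [|->//].
  by case/after_walk=> r' [wr' /(loc _ wr') eq_r <-].
by move: rt; rewrite uE => /set1P-> /set1P->.
Qed.

Lemma rows_of_cops_win_within t : 0 < #|G| ->
  cops_win_within G k t.+1 -> [set: G] \in P t.+2.
Proof.
move=> /card_gt0P[x0 _] [sigma win].
(* Here [s] indexes the probe just made and [i] counts those left; [v] picks a representative of
   each candidate class so far. *)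
suff solved i s v : s + i = t -> (forall m, m <= s -> v m \in before sigma v m) ->
    (forall m, m < s -> ~ exists u, after sigma v m = [set u]) ->
    after sigma v s \in P i.+1.
  rewrite rows_uptoSS; apply/orP; right; apply/existsP.
  apply/(distance_classes_probe x0); exists (sigma [::]) => u _.
  rewrite closed_nbhdT; apply: (solved t 0 (fun=> u)) => // m.
  by rewrite leqn0 => /eqP->; rewrite in_setT.
elim: i s v => [|i IHi] s v st vb unsolved.
  (* No probe is left: a real walk with these answers is located by time [s = t], and not
     earlier. *)
  have /after_walk[r [wr eq_a rs]] : v s \in after sigma v s.
    exact: probe_class_refl (vb _ _).
  have [m mt /(locatedP _ _ wr)] := win r wr.
  have ms : m < s.+1 by rewrite -(addn0 s) st.
  rewrite (after_answers (answers_take ms eq_a)) => solved_m.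
  move: ms; rewrite ltnS leq_eqVlt => /orP[/eqP ms|/unsolved//].
  by have [u] := solved_m; rewrite ms => ->; apply: set1_rows_upto.
have [[u ->]|nsolved] := pselect (exists u, after sigma v s = [set u]).
  exact: set1_rows_upto.
rewrite rows_uptoSS; apply/orP; right; apply/existsP.
apply/(distance_classes_probe x0); exists (sigma (answers sigma v s.+1)) => u uN.
(* Redirecting [v] to [u] after time [s] selects the class of [u] at the next probe. *)
pose v' m := if m <= s then v m else u.
have v'le m : m <= s.+1 -> forall n, n < m -> v' n = v n.
  by move=> ms n nm; rewrite /v' -ltnS (leq_trans nm ms).
have v's : v' s.+1 = u by rewrite /v' ltnn.
have := IHi s.+1 v'; rewrite /after beforeS v's (eq_answers _ (v'le _ (leqnn _))).
rewrite (after_answers (eq_answers _ (v'le _ (leqnn _)))).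
apply; first by rewrite addSnnS.
  move=> m; rewrite leq_eqVlt => /orP[/eqP->|ms].
    by rewrite beforeS v's (after_answers (eq_answers _ (v'le _ (leqnn _)))).
  rewrite (before_answers (eq_answers _ (v'le m (ltnW ms)))) (v'le m.+1) //.
  exact: vb.
move=> m ms; rewrite -/(after sigma v' m) (after_answers (eq_answers _ (v'le _ ms))).
by move: ms; rewrite ltnS leq_eqVlt => /orP[/eqP->|/unsolved].
Qed.

Lemma cops_win_within_of_rows t : 0 < #|G| ->
  [set: G] \in P t.+2 -> cops_win_within G k t.+1.
Proof.
move=> /card_gt0P[x0 _] Tt.
(* The implication inside the existential makes the choice of probe total: a good one if any,
   otherwise arbitrary. *)
have best i (Y : {set G}) : exists c : k.-tuple G,
    (exists c' : k.-tuple G, forall u, u \in Y -> probe_class c' Y u \in P i) ->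
    forall u, u \in Y -> probe_class c Y u \in P i.
  have [[c cP]|nc] := pselect (exists c : k.-tuple G,
      forall u, u \in Y -> probe_class c Y u \in P i); first by exists c.
  by exists [tuple x0 | _ < k] => /nc.
have [choose chooseP] := choice (fun p => best p.1 p.2).
(* A state holds the number of probes left and the current candidates; both are recovered from the
   answers alone. *)
pose next (p : nat * {set G}) (a : seq nat) :=
  (p.1.-1, closed_nbhd [set u in p.2 | probe (choose p) u == a]).
pose state h := foldl next (t.+1, [set: G]) h.
pose sigma : strategy G k := fun h => choose (state h).
exists sigma => r wr.
have stateE s : state (answers sigma r s) = (t.+1 - s, before sigma r s).
  elim: s => [|s IHs]; first by rewrite subn0.
  by rewrite answersS /state foldl_rcons -/(state _) IHs /next /= subnS /sigma IHs.
have solved s : s < t.+1 ->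
    (exists2 m, m < t.+1 & exists u, after sigma r m = [set u])
    \/ after sigma r s \in P (t.+1 - s).
  elim: s => [|s IHs]; rewrite ltnS => st.
    right; rewrite /after {1}/sigma stateE subn0.
    apply: chooseP; last exact: in_setT.
    case: (rows_upto_cases Tt) => [[u uE]|/(distance_classes_probe x0)].
      (* The graph has a single vertex here, so any probe will do. *)
      exists [tuple x0 | _ < k] => w _ /=.
      apply: rows_upto_hereditary (set1_rows_upto _ t u).
        by apply/set0Pn; exists w; rewrite probe_class_refl.
      by rewrite -uE subsetT.
    by rewrite closed_nbhdT.
  case: (IHs (leqW st)) => [|after_s]; [by left|].
  move: after_s; rewrite (subSn (ltnW st)) -(subnSK st).
  case/rows_upto_cases=> [sol|/(distance_classes_probe x0) sol].
    by left; exists s => //; apply: leqW.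
  right; rewrite /after {1}/sigma stateE subSS.
  apply: chooseP; last exact: mem_before_walk.
  by rewrite /= -/(after sigma r s); move: sol; rewrite (subnSK st).
have [[m mt /(locatedP _ _ wr) loc]|] := solved t (leqnn _); first by exists m.
rewrite subSn // subnn rows_upto1 => /existsP[u /eqP uE].
by exists t => //; apply/locatedP => //; exists u.
Qed.

End Candidates.

(** * From the bound on [zeta] to a bounded number of probes *)

Section Strategies.
Variable G : sgraph.

Lemma eq_located k (sigma : strategy G k) r r' t :
  (forall i, i <= t -> r i = r' i) -> located sigma r t -> located sigma r' t.
Proof.
move=> eq_r loc q wq; rewrite -(eq_answers sigma (t := t.+1) eq_r) => /(loc q wq)->.
exact: eq_r.
Qed.

(** Otherwise arbitrarily long unlocated walks yield, by [konig], an infinite one. Being located at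
    time [t] depends only on positions up to [t], so this walk defeats the strategy. *)
Lemma cops_win_bounded k : cops_win G k -> exists t, cops_win_within G k t.
Proof.
case=> sigma win; apply: contrapT => /forallNP nwin.
pose Q (s : seq G) := exists r, [/\ robber_walk r, s = mkseq r (size s)
  & forall i, i < size s -> ~ located sigma r i].
have [s s'|t|r rQ] := @konig _ Q.
- case=> r [wr ss' nloc]; exists r; split=> // [|i lt_is]; last first.
    by apply: nloc; rewrite size_cat ltn_addr.
  move: (congr1 (take (size s)) ss').
  rewrite take_size_cat // => {1}->; rewrite size_cat /mkseq -map_take take_iota.
  by rewrite (minn_idPl (leq_addr _ _)).
- have /existsNP[r /not_implyP[wr nloc]] : ~ forall r, robber_walk r ->
      exists2 s, s < t & located sigma r s.
    by move=> win_t; apply: (nwin t); exists sigma.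
  exists (mkseq r t); rewrite ?size_mkseq //; exists r; rewrite size_mkseq; split=> //.
  by move=> i it loc; apply: nloc; exists i.
have rQ' n : exists r', [/\ robber_walk r', forall i, i < n -> r' i = r i
    & forall i, i < n -> ~ located sigma r' i].
  have [r' [wr' eq_r nloc]] := rQ n; rewrite size_mkseq in eq_r nloc.
  exists r'; split=> // i it.
  by have := congr1 (nth (r i) ^~ i) eq_r; rewrite !nth_mkseq.
have wr : robber_walk r.
  move=> i; have [r' [wr' eq_r _]] := rQ' i.+2.
  by rewrite -!eq_r // wr'.
have [t loc] := win r wr; have [r' [_ eq_r nloc]] := rQ' t.+1.
by apply: (nloc t) => //; apply: eq_located loc => i it; rewrite eq_r.
Qed.

(** The extra cops always probe [x0], and their answers are cut off before consulting the old
    strategy. *)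
Lemma cops_win_mono k k' : 0 < #|G| -> k <= k' -> cops_win G k -> cops_win G k'.
Proof.
move=> /card_gt0P[x0 _] /subnKC <- [sigma win]; move: (k' - k) => m.
pose sigma' : strategy G (k + m) :=
  fun h => [tuple of sigma (map (take k) h) ++ nseq m x0].
have answersE r t : map (take k) (answers sigma' r t) = answers sigma r t.
  elim: t => //= t IHt; rewrite map_rcons IHt map_cat take_size_cat //.
  by rewrite size_map size_tuple.
exists sigma' => r wr; have [t loc] := win r wr; exists t => r' wr' eq_a.
by apply: loc => //; rewrite -!answersE eq_a.
Qed.

(** Probing every vertex reveals the robber at distance 0. This makes [zeta] a true minimum rather
    than the default value. *)
Lemma cops_win_card : connected_graph G -> cops_win G #|G|.
Proof.
case=> _ conn; exists (fun=> enum_tuple G) => r _; exists 0 => r' _ /= [].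
move=> /eq_in_map/(_ (r 0)); rewrite dist_refl mem_enum => /(_ isT) d0.
by rewrite (dist_eq0 (conn _ _) d0).
Qed.

Lemma cops_win_zeta k : connected_graph G -> zeta G <= k -> cops_win G k.
Proof.
move=> conn zk; apply: cops_win_mono zk _; first by case: conn.
by have [] := least_spec (cops_win_card conn).
Qed.

End Strategies.

Theorem theorem4p2 (G : sgraph) (n k : nat) :
  connected_graph G -> #|G| = n -> 0 < k -> zeta G <= k ->
  num_rows (@distance_colorings G k) = lcapt G k.
Proof.
move=> conn _ _ /(cops_win_zeta conn)/cops_win_bounded[t0 win0].
have G0 : 0 < #|G| by case: conn.
have [win min_t] := least_spec win0.
rewrite /lcapt /probes_needed; case: least win min_t => [|t] win min_t.
  (* Zero probes cannot suffice: a constant walk would have to be located at some [s < 0]. *)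
  have /card_gt0P[x0 _] := G0; case: win => sigma /(_ (fun=> x0))[] //.
  by move=> i; rewrite eqxx.
have j : #|set0 : {set G}| <= k by rewrite cards0.
apply: (num_rows_eq (exist (fun S : {set G} => #|S| <= k) set0 j)) => //.
  exact: rows_of_cops_win_within.
case: t win min_t => // t _ min_t _; apply/negP => /(cops_win_within_of_rows G0).
by move/min_t; rewrite ltnn.
Qed.
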